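(* Let $X$ be a real Hilbert space, let $E\subset X$ be a nonempty subset, let $f:E\to\mathbb{R}$ and $G:E\to X$ be functions, and let $M>0$. Suppose that $(f,G)$ satisfies property $(CW^{1,1})$ with constant $M$ on $E$, that is, $$f(x)\ge f(y)+\langle G(y),x-y\rangle+\frac{1}{2M}\|G(x)-G(y)\|^2\quad\text{for all }x,y\in E.$$ Then the formula $$F=\mathrm{conv}(g),\qquad g(x)=\inf_{y\in E}\Big\{f(y)+\langle G(y),x-y\rangle+\tfrac{M}{2}\|x-y\|^2\Big\},\quad x\in X,$$ defines a $C^{1,1}$ convex function $F:X\to\mathbb{R}$ such that $F|_E=f$, $(\nabla F)|_E=G$, and $\mathrm{Lip}(\nabla F)\le M$. Moreover, if $H:X\to\mathbb{R}$ is another $C^{1,1}$ convex function with $H|_E=f$, $(\nabla H)|_E=G$, and $\mathrm{Lip}(\nabla H)\le M$, then $H\le F$ on $X$.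
   Context: For $g:X\to\mathbb{R}$, the convex envelope is $\mathrm{conv}(g)(x)=\sup\{\phi(x):\phi\text{ is convex, proper and lower semicontinuous on }X,\ \phi\le g\}$. A function $F:X\to\mathbb{R}$ is of class $C^{1,1}$ if it is differentiable with Lipschitz gradient $\nabla F:X\to X$; $\mathrm{Lip}(\nabla F)$ denotes the Lipschitz constant of $\nabla F$. *)

(* Defs.v *)
From HB Require Import structures.
From mathcomp Require Import all_boot all_order all_algebra.
From mathcomp Require Import all_classical all_reals all_analysis.

Set Implicit Arguments.
Unset Strict Implicit.
Unset Printing Implicit Defensive.

Import Order.TTheory GRing.Theory Num.Theory.
Import numFieldNormedType.Exports.

Local Open Scope classical_set_scope.
Local Open Scope ring_scope.

(* A real Hilbert space is rendered as [X : completeNormedModType R] together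
   with a symmetric positive definite form [ip : {dot X for idfun}] such that
   [ip x x = `|x| ^+ 2]; completeness and all topological notions on [X] are
   those of the norm. *)

Section ConvexEnvelope.
Context {R : realType} {X : normedModType R}.
Implicit Type phi : X -> \bar R.

Definition proper_fun phi : Prop :=
  (forall x, -oo < phi x)%E /\ (exists x, phi x < +oo)%E.

(* Only used for functions that are also [proper_fun]: the value -oo does not
   occur, so the right-hand side is never of the form +oo - oo (and
   0 * +oo = 0 makes the cases t = 0 and t = 1 trivial). *)
Definition ereal_convex phi : Prop :=
  forall (t : R) (x y : X), 0 <= t <= 1 ->
    (phi (t *: x + (1 - t) *: y)%R <= t%:E * phi x + (1 - t)%:E * phi y)%E.

Definition conv_env (g : X -> R) (x : X) : \bar R :=
  ereal_sup [set phi x | phi in [set phi : X -> \bar R |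
    [/\ ereal_convex phi, proper_fun phi, lower_semicontinuous phi
      & forall z, (phi z <= (g z)%:E)%E]]].

End ConvexEnvelope.

Section Gradient.
Context {R : realType} {X : completeNormedModType R}.
Variable ip : {dot X for idfun}.

(* The Riesz representative of the Frechet differential; meaningful where F is
   differentiable, with default value 0 otherwise. *)
Definition gradient (F : X -> R) (x : X) : X :=
  xget 0 [set v | forall h, 'd F x h = ip v h].

Definition C11 (F : X -> R) : Prop :=
  (forall x, differentiable F x) /\ lipschitz (gradient F).

End Gradient.

(* The pairs with x = y contribute 0, because 0^-1 = 0; hence the supremum is
   that of 0 and of the quotients with x <> y. *)
Definition Lip {R : realType} {X : normedModType R} (u : X -> X) : \bar R :=
  ereal_sup [set (`|u p.1 - u p.2| / `|p.1 - p.2|)%:E | p in [set: X * X]].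

Section CW11.
Context {R : realType} {X : completeNormedModType R}.
Variable ip : {dot X for idfun}.
Variables (E : set X) (f : X -> R) (G : X -> X) (M : R).

Definition CW11 : Prop := forall x y, E x -> E y ->
  f y + ip (G y) (x - y) + (2 * M)^-1 * `|G x - G y| ^+ 2 <= f x.

Definition inf_paraboloids (x : X) : \bar R :=
  ereal_inf [set (f y + ip (G y) (x - y) + M / 2 * `|x - y| ^+ 2)%:E
            | y in E].

End CW11.

(* Main.v *)
Require Import Defs.
From HB Require Import structures.
From mathcomp Require Import all_boot all_order all_algebra.
From mathcomp Require Import all_classical all_reals all_analysis.
From mathcomp Require Import ring lra.

Set Implicit Arguments.
Unset Strict Implicit.
Unset Printing Implicit Defensive.

Import Order.TTheory GRing.Theory Num.Theory.
Import numFieldNormedType.Exports.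

Local Open Scope classical_set_scope.
Local Open Scope ring_scope.

(** The envelope [F = conv g] is squeezed between two families indexed by [E],
    the affine functions [x |-> f z + ip (G z) (x - z)] and the paraboloids
    obtained from them by adding [M / 2 * `|x - z| ^+ 2]. Completing a square,
    the condition [CW11] says exactly that every affine function lies below
    every paraboloid ([tangent_le_paraboloid]); hence [g] is finite, [F] is
    finite, and both functions of index [z] touch [F] at [z]. This contact gives
    [F z = f z] and [gradient F z = G z] ([conv_env_touch]).

    Regularity away from [E] comes from semiconcavity. An infimum of paraboloids
    of opening [M] is [M]-semiconcave, and the convex envelope inherits this
    ([conv_env_semiconcave]): for fixed [t] and [d], the function
    [w |-> t * F (w + (1 - t) *: d) + (1 - t) * F (w - t *: d)
    - M / 2 * (t * (1 - t)) * `|d| ^+ 2] is convex and lower semicontinuous, and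
    it is below [g] because [F] is below [g] and [g] is semiconcave; so it is
    below [F], which is the semiconcavity of [F].

    A function that is convex, [M]-semiconcave and locally bounded above has at
    every [x] a vector [v] with
    [F x + ip v h <= F (x + h) <= F x + ip v h + M / 2 * `|h| ^+ 2] for all [h]
    ([convex_semiconcave_quad_touch]): convexity makes the one-sided directional
    derivative exist, the two inequalities together make it linear, the local
    bound makes it bounded, and the Riesz representation theorem ([riesz])
    provides [v]. These inequalities force differentiability with gradient [v]
    ([quad_touch_gradient]), and comparing them at two points gives the
    cocoercivity of the gradient, hence its Lipschitz bound
    ([quad_touch_lipschitz]).

    For maximality, the descent lemma ([descent]) puts any competitor [H] below
    every paraboloid, so [H <= g]; being convex and continuous, [H] is one of
    the functions of which [F] is the supremum. *)

(** * Convex functions, lower semicontinuity and the convex envelope *)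

Section ConvexFunctions.
Context {R : realType} {X : normedModType R}.
Implicit Types (x y p : X) (F : X -> R).

Definition convex_fun F := forall (t : R) x y, 0 <= t <= 1 ->
  F (t *: x + (1 - t) *: y) <= t * F x + (1 - t) * F y.

Lemma convex_funP F :
  convex_fun F <-> convex_function [set: convex_lmodType X] F.
Proof.
split=> [cF t x y _ _|cF t x y t01].
  by apply: cF; rewrite ge0 le1.
have /andP[t0 t1] := t01.
exact: (cF (Itv01 t0 t1) x y (mem_set I) (mem_set I)).
Qed.

(** In a Hilbert space this is concavity of [x |-> F x - M / 2 * `|x| ^+ 2]. *)
Definition semiconcave (M : R) F := forall (t : R) x y, 0 <= t <= 1 ->
  t * F x + (1 - t) * F y - M / 2 * (t * (1 - t)) * `|x - y| ^+ 2
    <= F (t *: x + (1 - t) *: y).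

(** Lower semicontinuity of a finite function in the additive form that is
    stable under sums; see [lscP] for the topological form. *)
Definition lsc F := forall x (e : R), 0 < e -> \forall y \near x, F x - e < F y.

Lemma lscP F : lsc F <-> lower_semicontinuous (EFin \o F).
Proof.
split=> [lscF x a /=|lscF x e e0].
  rewrite lte_fin => aF.
  have Fa : 0 < F x - a by rewrite subr_gt0.
  exists [set y | F x - (F x - a) < F y]; first exact: lscF.
  by move=> y /=; rewrite subKr lte_fin.
have [|V xV VF] := lscF x (F x - e).
  by rewrite /= lte_fin ltrBlDr ltrDl.
by apply: filterS xV => y /VF; rewrite /= lte_fin.
Qed.

Lemma continuous_lsc F : continuous F -> lsc F.
Proof.
move=> cF x e e0; have /cvgrPdist_lt/(_ e e0) := cF x.
by apply: filterS => y; rewrite ltr_norml => /andP[]; lra.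
Qed.

Lemma lsc_shift F p : lsc F -> lsc (fun x => F (x + p)).
Proof.
move=> lF x e /(lF (x + p)) near_xp.
have : (fun y => y + p) @ x --> x + p.
  by apply: cvgD; [exact: cvg_id|exact: cvg_cst].
by move/(_ _ near_xp).
Qed.

Lemma lsc_comb F1 F2 (t : R) : 0 <= t <= 1 -> lsc F1 -> lsc F2 ->
  lsc (fun x => t * F1 x + (1 - t) * F2 x).
Proof.
move=> /andP[t0 t1] l1 l2 x e e0; near=> y.
have H1 : F1 x - e / 2 < F1 y by near: y; apply: l1; rewrite divr_gt0.
have H2 : F2 x - e / 2 < F2 y by near: y; apply: l2; rewrite divr_gt0.
have t1' : 0 <= 1 - t by rewrite subr_ge0.
have := ler_wpM2l t0 (ltW H1); have := ler_wpM2l t1' (ltW H2); lra.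
Unshelve. all: by end_near. Qed.

Lemma lsc_addr F (c : R) : lsc F -> lsc (fun x => F x + c).
Proof. by move=> lF x e /(lF x); apply: filterS => y; lra. Qed.

Lemma conv_env_le (g : X -> R) x : (conv_env g x <= (g x)%:E)%E.
Proof. by apply: ge_ereal_sup => _ [phi [_ _ _ phig] <-]. Qed.

Lemma le_conv_env (g u : X -> R) : convex_fun u -> lsc u ->
  (forall x, u x <= g x) -> forall x, ((u x)%:E <= conv_env g x)%E.
Proof.
move=> cu lu ug x; apply: ereal_sup_ubound.
exists (EFin \o u) => //; split.
- by move=> t y z t01; rewrite /= -!EFinM -EFinD lee_fin cu.
- by split=> [y|]; [rewrite /= ltNyr|exists x; rewrite /= ltry].
- exact/lscP.
- by move=> z; rewrite lee_fin.
Qed.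

Section Envelope.
Variables (g F : X -> R).
Hypothesis FE : forall x, (F x)%:E = conv_env g x.

Let F_le_g x : F x <= g x.
Proof. by rewrite -lee_fin FE conv_env_le. Qed.

Let F_max (u : X -> R) : convex_fun u -> lsc u ->
  (forall x, u x <= g x) -> forall x, u x <= F x.
Proof. by move=> cu lu ug x; rewrite -lee_fin FE le_conv_env. Qed.

Lemma conv_env_convex : convex_fun F.
Proof.
move=> t x y t01; have /andP[t0 t1] := t01.
rewrite -lee_fin FE; apply: ge_ereal_sup => _ [phi phiP <-].
have phiF z : (phi z <= (F z)%:E)%E.
  by rewrite FE; apply: ereal_sup_ubound; exists phi.
have [cphi _ _ _] := phiP.
apply: (le_trans (cphi t x y t01)).
rewrite [leRHS]EFinD !EFinM; apply: leeD; apply: lee_wpmul2l => //.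
by rewrite lee_fin subr_ge0.
Qed.

Lemma conv_env_lsc : lsc F.
Proof.
move=> x e e0.
have : ((F x - e)%:E < conv_env g x)%E by rewrite -FE lte_fin ltrBlDr ltrDl.
move=> /ereal_sup_gt[_ [phi phiP <-]] Fphi.
have [_ _ lphi _] := phiP.
have [V xV VF] := lphi _ _ Fphi.
apply: filterS xV => y /VF H; rewrite -lte_fin; apply: (lt_le_trans H).
by rewrite FE; apply: ereal_sup_ubound; exists phi.
Qed.

(** The left-hand side of semiconcavity, with the displacement frozen and the
    base point moving, is itself a convex lower semicontinuous minorant of [g]:
    maximality of the envelope among such functions is the whole proof. *)
Lemma conv_env_semiconcave M : semiconcave M g -> semiconcave M F.
Proof.
move=> sg t x y t01; have /andP[t0 t1] := t01.
pose z := t *: x + (1 - t) *: y.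
have [d dE] : exists d, d = x - y by exists (x - y).
pose u w := t * F (w + (1 - t) *: d) + (1 - t) * F (w + - (t *: d))
            + - (M / 2 * (t * (1 - t)) * `|d| ^+ 2).
have xE : z + (1 - t) *: d = x.
  rewrite /z dE scalerBr addrACA subrr addr0 -scalerDl (addrC t) subrK.
  by rewrite scale1r.
have yE : z - t *: d = y.
  rewrite /z dE scalerBr opprB addrC addrA subrK -scalerDl (addrC t) subrK.
  by rewrite scale1r.
suff /(_ z) : forall w, u w <= F w by rewrite /u xE yE dE.
apply: F_max.
- move=> s a b s01; rewrite /u.
  have sh p : s *: a + (1 - s) *: b + p = s *: (a + p) + (1 - s) *: (b + p).
    by rewrite !scalerDr addrACA -scalerDl (addrC s) subrK scale1r.
  rewrite !sh.
  have H1 := conv_env_convex (a + (1 - t) *: d) (b + (1 - t) *: d) s01.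
  have H2 := conv_env_convex (a + - (t *: d)) (b + - (t *: d)) s01.
  have t1' : 0 <= 1 - t by rewrite subr_ge0.
  have := ler_wpM2l t0 H1; have := ler_wpM2l t1' H2; lra.
- apply: lsc_addr; apply: lsc_comb => //; exact/lsc_shift/conv_env_lsc.
move=> w; have := sg t (w + (1 - t) *: d) (w - t *: d) t01.
have -> : t *: (w + (1 - t) *: d) + (1 - t) *: (w - t *: d) = w.
  rewrite !scalerDr addrACA -scalerDl (addrC t) subrK scale1r scalerN !scalerA.
  by rewrite mulrC subrr addr0.
have -> : w + (1 - t) *: d - (w - t *: d) = d.
  by rewrite opprB addrC addrA subrK -scalerDl (addrC t) subrK scale1r.
apply: le_trans; rewrite /u lerD2r.
by apply: lerD; apply: ler_wpM2l => //; rewrite ?subr_ge0 // F_le_g.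
Qed.

End Envelope.

End ConvexFunctions.

(** * Inner products and the Riesz representation theorem *)

Section InnerProduct.
Context {R : realType} {X : completeNormedModType R}.
Variable ip : {dot X for idfun}.
Hypothesis ip_norm : forall x : X, ip x x = `|x| ^+ 2.
Implicit Types (x y u v h : X) (F : X -> R).

Lemma ipC x y : ip x y = ip y x.
Proof. by have /= := hermC ip x y; rewrite expr0 mul1r. Qed.

Lemma ipDl x y u : ip (x + y) u = ip x u + ip y u.
Proof. exact: linearDl. Qed.

Lemma ipNl x u : ip (- x) u = - ip x u.
Proof. exact: linearNl. Qed.

Lemma ipBl x y u : ip (x - y) u = ip x u - ip y u.
Proof. exact: linearBl. Qed.

Lemma ipZl (a : R) x u : ip (a *: x) u = a * ip x u.
Proof. by rewrite linearZl. Qed.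

Lemma ipDr x y u : ip u (x + y) = ip u x + ip u y.
Proof. exact: linearDr. Qed.

Lemma ipNr x u : ip u (- x) = - ip u x.
Proof. exact: linearNr. Qed.

Lemma ipBr x y u : ip u (x - y) = ip u x - ip u y.
Proof. exact: linearBr. Qed.

Lemma ipZr (a : R) x u : ip u (a *: x) = a * ip u x.
Proof. by rewrite ipC ipZl ipC. Qed.

Definition ipE := (ipDl, ipBl, ipNl, ipZl, ipDr, ipBr, ipNr, ipZr).

Lemma ip_ge0 x : 0 <= ip x x.
Proof. by rewrite ip_norm exprn_ge0. Qed.

Lemma ip_inj u v : (forall h, ip u h = ip v h) -> u = v.
Proof.
move=> uv; apply/eqP; rewrite -subr_eq0 -normr_eq0 -sqrf_eq0 -ip_norm.
by rewrite ipBl uv subrr.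
Qed.

(** Cauchy-Schwarz, from the squared norm of [`|y| *: x - `|x| *: y]. *)
Lemma ip_le_norm x y : ip x y <= `|x| * `|y|.
Proof.
have := ip_ge0 (`|y| *: x - `|x| *: y).
rewrite !ipE !ip_norm (ipC y x) => H.
have [->|x0] := eqVneq x 0; first by rewrite linear0l normr0 mul0r.
have [->|y0] := eqVneq y 0; first by rewrite linear0r normr0 mulr0.
have p : 0 < `|x| * `|y| by rewrite mulr_gt0 ?normr_gt0.
rewrite -(ler_pM2l p); nra.
Qed.

Lemma normr_ip_le x y : `|ip x y| <= `|x| * `|y|.
Proof.
by rewrite ler_norml ip_le_norm andbT lerNl -ipNl -(normrN x) ip_le_norm.
Qed.

Lemma bounded_linear_continuous (L : {linear X -> R}) (C : R) :
  (forall h, `|L h| <= C * `|h|) -> continuous L.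
Proof.
move=> LC; apply/linear_bounded_continuous/linear_boundedP.
near=> r => h; apply: (le_trans (LC h)).
by rewrite ler_wpM2r //; near: r; exact: nbhs_pinfty_ge.
Unshelve. all: by end_near. Qed.

Lemma ip_is_linear v : linear (ip v : X -> R).
Proof. by move=> a x y; rewrite ipDr ipZr. Qed.

(** [ip v] as a linear map for the module structure of [R] over itself, which
    is the one that differentials use. *)
Definition ip_lin v : {linear X -> R} :=
  HB.pack (ip v : X -> R)
    (GRing.isLinear.Build R X R _ (ip v) (ip_is_linear v)).

Lemma ip_lin_continuous v : continuous (ip_lin v).
Proof.
by apply: (@bounded_linear_continuous _ `|v|) => h; exact: normr_ip_le.
Qed.

(** The representing vector minimizes the quadratic functional
    [J u = `|u| ^+ 2 - 2 * L u]. By the parallelogram law a minimizing sequence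
    is Cauchy; almost minimality of [u n] on the lines through [u n] bounds
    [ip (u n) h - L h], and this bound passes to the limit. *)
Lemma riesz (L : {linear X -> R}) :
  (exists C, forall h, `|L h| <= C * `|h|) -> exists v, forall h, L h = ip v h.
Proof.
case=> C LC.
have LZ a h : L (a *: h) = a * L h by rewrite linearZ.
have LD h k : L (h + k) = L h + L k by rewrite linearD.
pose J u := ip u u - 2 * L u.
have J_ge u : - C ^+ 2 <= J u.
  have := LC u; rewrite /J ip_norm ler_norml => /andP[_ LuC].
  have := sqr_ge0 (`|u| - C); lra.
have infJ : has_inf (range J).
  by split; [exists (J 0), 0 | exists (- C ^+ 2) => _ [u _ <-]].
pose m := inf (range J).
have J_inf u : m <= J u by apply: ge_inf; [exact: infJ.2 | exists u].
have /choice[u uP] (n : nat) : exists u, J u < m + harmonic n.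
  have [|_ [u _ <-]] := @inf_adherent _ _ (harmonic n) _ infJ.
    exact: harmonic_gt0.
  by exists u.
(* compare [J] at the midpoint with its infimum *)
have u_cauchy n p : `|u n - u p| ^+ 2 <= 2 * (harmonic n + harmonic p).
  have := J_inf (2^-1 *: (u n + u p)); have := uP n; have := uP p.
  rewrite /J -ip_norm LZ LD !ipE (ipC (u p) (u n)).
  move: (harmonic n) (harmonic p) => e e'; move: (L _) (L _) => ? ?.
  lra.
have u_slope n h : (ip (u n) h - L h) ^+ 2 <= harmonic n * `|h| ^+ 2.
  have [->|h0] := eqVneq h 0.
    by rewrite linear0r linear0 normr0 subrr !expr0n mulr0.
  have hp : 0 < `|h| ^+ 2 by rewrite exprn_gt0 ?normr_gt0.
  set a := _ - _; set e := harmonic n.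
  have H t : 0 <= e + 2 * t * a + t ^+ 2 * `|h| ^+ 2.
    have := J_inf (u n + t *: h); have := uP n.
    rewrite /J -ip_norm LD LZ !ipE (ipC h (u n)) /a /e.
    nra.
  (* the value of [t] that minimizes the right-hand side of [H] *)
  have {H} := H (- (a / `|h| ^+ 2)); rewrite -(ler_pM2r hp 0) mul0r.
  have -> : (e + 2 * - (a / `|h| ^+ 2) * a
      + (- (a / `|h| ^+ 2)) ^+ 2 * `|h| ^+ 2) * `|h| ^+ 2
      = e * `|h| ^+ 2 - a ^+ 2 by field; rewrite normr_eq0.
  by rewrite subr_ge0.
have harmonic_small (e : R) : 0 < e ->
    exists N, forall n, (N <= n)%N -> harmonic n < e.
  move=> e0; have [N _ HN] := proj1 (cvgrPdist_lt _ _) (@cvg_harmonic R) _ e0.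
  by exists N => n /HN; rewrite /= sub0r normrN ger0_norm ?harmonic_ge0.
have /cvg_ex[v uv] : cvgn u.
  apply/cauchy_cvgP/cauchy_ballP => eps eps_gt0.
  have eps4_gt0 : 0 < eps ^+ 2 / 4 by rewrite divr_gt0 ?exprn_gt0.
  have [N small] := harmonic_small _ eps4_gt0.
  exists (u @` [set n | (N <= n)%N], u @` [set n | (N <= n)%N]) => /=.
    by split; exists N => // n Nn; exists n.
  move=> [_ _] /= [[n Nn <-] [p Np <-]].
  rewrite -ball_normE /= -(@ltr_pXn2r _ 2) ?nnegrE ?normr_ge0 ?ltW //.
  have := u_cauchy n p; have := small _ Nn; have := small _ Np; lra.
exists v => h; apply/eqP; rewrite -subr_eq0 -normr_le0.
apply/ler_addgt0Pr => d d_gt0; rewrite add0r.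
(* an error [e] both in [v] and in the slope at [u n] costs [2 * e * `|h|];
   the summand 1 only avoids dividing by zero *)
pose e := d / (2 * (`|h| + 1)).
have h1 : 0 < 2 * (`|h| + 1) by rewrite mulr_gt0 // ltr_wpDl.
have e_gt0 : 0 < e by rewrite divr_gt0.
have eh : 2 * e * `|h| <= d.
  have : e * (2 * (`|h| + 1)) = d by rewrite /e divfK ?gt_eqF.
  nra.
have e2 : 0 < e ^+ 2 by rewrite exprn_gt0.
have [n [un hn]] : exists n, `|v - u n| < e /\ harmonic n < e ^+ 2.
  have [N HN] := harmonic_small _ e2.
  have [K _ HK] := proj1 (cvgrPdist_lt _ _) uv _ e_gt0.
  exists (maxn N K); split; first by apply: HK; exact: leq_maxr.
  by apply: HN; exact: leq_maxl.
have -> : L h - ip v h = - ip (v - u n) h - (ip (u n) h - L h).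
  by rewrite ipBl; ring.
apply: (le_trans (ler_normB _ _)); rewrite normrN.
have := normr_ip_le (v - u n) h.
have : `|ip (u n) h - L h| <= e * `|h|.
  have eh0 : 0 <= e * `|h| by rewrite mulr_ge0 // ltW.
  rewrite -(@ler_pXn2r _ 2) ?nnegrE // real_normK ?num_real // exprMn.
  by apply: (le_trans (u_slope n h)); rewrite ler_wpM2r ?exprn_ge0 // ltW.
have := normr_ge0 h; nra.
Qed.

(** * Quadratic contact and the gradient *)

(** The first inequality says that [v] is a subgradient of [F] at [x]; the
    second one replaces the remainder [o(h)] by a quadratic term with a constant
    uniform in [x], which is what yields a Lipschitz bound. *)
Definition quad_touch F (M : R) x v := forall h,
  F x + ip v h <= F (x + h) <= F x + ip v h + M / 2 * `|h| ^+ 2.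

(** Riesz applied to the differential: the set from which [gradient] picks its
    value is nonempty at a point of differentiability. *)
Lemma gradientP F x : differentiable F x ->
  forall h, 'd F x h = ip (gradient ip F x) h.
Proof.
move=> Fx; have [k _ Hk] := linear_lipschitz (diff_continuous Fx).
have [v Hv] := riesz (ex_intro _ k Hk).
by apply: (@xgetPex _ 0 [set v | forall h, 'd F x h = ip v h]); exists v.
Qed.

Lemma quad_touch_gradient F M x v : quad_touch F M x v ->
  differentiable F x /\ gradient ip F x = v.
Proof.
move=> Fxv.
have dF : F \o shift x = cst (F x) + ip_lin v +o_ 0 id.
  apply: eqaddoE; apply/eqaddoP => e e_gt0.
  near=> h; rewrite /= !fctE /=.
  have := Fxv h; rewrite (addrC x) => /andP[lo hi].
  have hM : M * `|h| <= e.
    suff : `|h| <= e / (`|M| + 1).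
      rewrite ler_pdivlMr ?ltr_wpDl // => hM.
      by have := ler_norm M; have := normr_ge0 h; nra.
    near: h; apply/nbhs0_le; by rewrite divr_gt0 ?ltr_wpDl.
  rewrite ler_norml; apply/andP; split.
    have : 0 <= e * `|h| by rewrite mulr_ge0 // ltW.
    lra.
  by have := normr_ge0 h; nra.
have d_eq : 'd F x = ip v :> (X -> R) := diff_unique (@ip_lin_continuous v) dF.
have Fx : differentiable F x.
  apply/diff_locallyP; split; last by rewrite d_eq.
  by rewrite d_eq; exact: (@ip_lin_continuous v).
by split=> //; apply: ip_inj => h; rewrite -gradientP // d_eq.
Unshelve. all: by end_near. Qed.

(** Compare the lower bound of [F] from [y] and its upper bound from [x] at the
    point [x - M^-1 *: (v - w)], where the upper bound minus the lower bound is
    smallest. *)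
Lemma quad_touch_cocoercive F M x y v w : 0 < M ->
  quad_touch F M x v -> quad_touch F M y w ->
  F y + ip w (x - y) + (2 * M)^-1 * `|v - w| ^+ 2 <= F x.
Proof.
move=> M_gt0 Fx Fy.
have : ip (v - w) (v - w) = ip v (v - w) - ip w (v - w) by rewrite -ipBl.
move: (v - w) => d dd; set m := M^-1.
have Mm : M * m = 1 by rewrite mulfV // gt_eqF.
have /andP[_] := Fx (- (m *: d)); have /andP[+ _] := Fy (x - m *: d - y).
rewrite subrKC normrN normrZ exprMn real_normK ?num_real // -ip_norm.
move=> /le_trans H /H; rewrite addrAC !ipBr ipNr !ipZr invfM.
have -> : M / 2 * (m ^+ 2 * ip d d) = m / 2 * ip d d.
  by rewrite -[m in RHS]mul1r -Mm; ring.
rewrite -/m dd; lra.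
Qed.

(** Adding cocoercivity for [(x, y)] and [(y, x)] bounds
    [M^-1 * `|G x - G y| ^+ 2] by [ip (G x - G y) (x - y)]; Cauchy-Schwarz
    concludes. *)
Lemma quad_touch_lipschitz F M (G : X -> X) : 0 < M ->
  (forall x, quad_touch F M x (G x)) ->
  forall x y, `|G x - G y| <= M * `|x - y|.
Proof.
move=> M_gt0 FG x y.
have := quad_touch_cocoercive M_gt0 (FG x) (FG y).
have := quad_touch_cocoercive M_gt0 (FG y) (FG x).
rewrite (distrC (G y)) => H1 H2.
have H : M^-1 * `|G x - G y| ^+ 2 <= ip (G x - G y) (x - y).
  move: H1 H2; rewrite invfM !ipE; lra.
have CS := ip_le_norm (G x - G y) (x - y).
have [->|n0] := eqVneq `|G x - G y| 0; first by rewrite mulr_ge0 // ltW.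
have np : 0 < `|G x - G y| by rewrite lt_neqAle eq_sym n0 normr_ge0.
rewrite -(ler_pM2l np) -(ler_pM2l (_ : 0 < M^-1)) ?invr_gt0 //.
have -> : M^-1 * (`|G x - G y| * (M * `|x - y|)) = `|G x - G y| * `|x - y|.
  by field; rewrite gt_eqF.
by rewrite -expr2; exact: le_trans H CS.
Qed.

(** * Directional derivatives of convex semiconcave functions *)

Section DirectionalDerivative.
Variables (M : R) (F : X -> R) (x : X).
Hypotheses (M_ge0 : 0 <= M) (F_conv : convex_fun F) (F_semi : semiconcave M F).

Let D h := F (x + h) - F x.

Let D_conv (t : R) h k : 0 <= t <= 1 ->
  D (t *: h + (1 - t) *: k) <= t * D h + (1 - t) * D k.
Proof.
move=> t01; have := F_conv (x + h) (x + k) t01.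
have -> : t *: (x + h) + (1 - t) *: (x + k) = x + (t *: h + (1 - t) *: k).
  by rewrite !scalerDr addrACA -scalerDl (addrC t) subrK scale1r.
rewrite /D; lra.
Qed.

Let D_semi (t : R) h k : 0 <= t <= 1 ->
  t * D h + (1 - t) * D k - M / 2 * (t * (1 - t)) * `|h - k| ^+ 2 <=
  D (t *: h + (1 - t) *: k).
Proof.
move=> t01; have := F_semi (x + h) (x + k) t01.
have -> : t *: (x + h) + (1 - t) *: (x + k) = x + (t *: h + (1 - t) *: k).
  by rewrite !scalerDr addrACA -scalerDl (addrC t) subrK scale1r.
have -> : x + h - (x + k) = h - k by rewrite opprD addrACA subrr add0r.
rewrite /D; lra.
Qed.

Let D0 : D 0 = 0. Proof. by rewrite /D addr0 subrr. Qed.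

Let DZ_le (r : R) h : 0 <= r <= 1 -> D (r *: h) <= r * D h.
Proof. by move=> /(D_conv h 0); rewrite scaler0 addr0 D0 mulr0 addr0. Qed.

Let DZ_ge (r : R) h : 0 <= r <= 1 ->
  r * D h - M / 2 * (r * (1 - r)) * `|h| ^+ 2 <= D (r *: h).
Proof.
by move=> /(D_semi h 0); rewrite scaler0 !addr0 D0 mulr0 subr0 addr0.
Qed.

Let slopes h := [set t^-1 * D (t *: h) | t in [set t : R | 0 < t]].

(** The difference quotients of a convex function increase with the step, so
    that their infimum is the one-sided derivative of [F] at [x] in the
    direction [h]. *)
Definition dirder h := inf (slopes h).

(** Semiconcavity makes a quotient exceed those of smaller steps by at most a
    multiple of its own step. *)
Let slopes_lb h (s : R) : 0 < s ->
  lbound (slopes h) (s^-1 * (D (s *: h) - M / 2 * (s ^+ 2 * `|h| ^+ 2))).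
Proof.
move=> s0 _ [t /= t0 <-].
rewrite ler_pdivrMl // [leRHS]mulrCA ler_pdivlMl //.
have MN : 0 <= M / 2 * `|h| ^+ 2 by rewrite mulr_ge0 ?divr_ge0 ?exprn_ge0.
have [ts|/ltW st] := leP t s.
  have r01 : 0 <= t / s <= 1.
    by rewrite divr_ge0 ?(ltW t0) ?(ltW s0) //= ler_pdivrMr // mul1r.
  have := DZ_ge (s *: h) r01.
  rewrite scalerA divfK ?gt_eqF // normrZ exprMn real_normK ?num_real //.
  rewrite -(ler_pM2l s0).
  set r := t / s in r01 *; have -> : t = r * s by rewrite /r divfK ?gt_eqF.
  have /andP[r0 r1] := r01.
  have : 0 <= r ^+ 2 * s ^+ 3 * (M / 2 * `|h| ^+ 2).
    by rewrite mulr_ge0 // mulr_ge0 // exprn_ge0 // ltW.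
  lra.
have r01 : 0 <= s / t <= 1.
  by rewrite divr_ge0 ?(ltW t0) ?(ltW s0) //= ler_pdivrMr // mul1r.
have := DZ_le (t *: h) r01; rewrite scalerA divfK ?gt_eqF //.
rewrite -(ler_pM2l t0).
have -> : t * (s / t * D (t *: h)) = s * D (t *: h) by field; rewrite gt_eqF.
move=> H.
have : 0 <= t * (s ^+ 2 * (M / 2 * `|h| ^+ 2)).
  by rewrite mulr_ge0 ?(ltW t0) // mulr_ge0 // exprn_ge0 // ltW.
lra.
Qed.

Let slopes_n0 h : slopes h !=set0.
Proof. by exists (1^-1 * D (1 *: h)), 1 => //=. Qed.

Let dirder_le h (s : R) : 0 < s -> s * dirder h <= D (s *: h).
Proof.
move=> s0; rewrite -ler_pdivlMl //; apply: ge_inf; last by exists s.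
by eexists; exact: (slopes_lb s0).
Qed.

Let dirder_ge h (s : R) : 0 < s ->
  D (s *: h) <= s * dirder h + M / 2 * `|h| ^+ 2 * s ^+ 2.
Proof.
move=> s0; have := lb_le_inf (slopes_n0 h) (slopes_lb s0).
rewrite ler_pdivrMl // -/(dirder h); lra.
Qed.

(** Second-order accuracy along a ray characterizes the derivative; additivity
    and homogeneity of [dirder] are checked through this criterion. *)
Let dirder_uniq h (a C : R) :
  (forall s : R, 0 < s -> `|D (s *: h) - s * a| <= C * s ^+ 2) -> dirder h = a.
Proof.
move=> H; apply/eqP; rewrite -subr_eq0 -normr_le0.
apply/ler_addgt0Pr => e e0; rewrite add0r.
pose K := `|C| + M / 2 * `|h| ^+ 2 + 1.
have MN : 0 <= M / 2 * `|h| ^+ 2 by rewrite mulr_ge0 ?divr_ge0 ?exprn_ge0.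
have K0 : 0 < K by rewrite ltr_wpDl // addr_ge0.
pose s := e / K; have s0 : 0 < s by rewrite divr_gt0.
have sK : s * K = e by rewrite /s divfK ?gt_eqF.
have := dirder_le h s0; have := dirder_ge h s0; have := H s s0.
rewrite ler_norml => /andP[H1 H2] H3 H4.
have CK : C <= `|C| := ler_norm C.
have s2 : 0 < s ^+ 2 by rewrite exprn_gt0.
have CKs := ler_wpM2r (ltW s2) CK; rewrite -sK /K.
by rewrite ler_norml; apply/andP; split; rewrite -(ler_pM2l s0); lra.
Qed.

Let dirderD h k : dirder (h + k) = dirder h + dirder k.
Proof.
apply: (@dirder_uniq _ _ (M * (`|h| ^+ 2 + `|k| ^+ 2 + `|h - k| ^+ 2))) => s s0.
have half01 : 0 <= (2^-1 : R) <= 1 by lra.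
have s20 : 0 < 2 * s by lra.
(* [x + s *: (h + k)] is the midpoint of the steps [2 * s] along [h] and [k] *)
have -> : s *: (h + k) = 2^-1 *: (2 * s *: h) + (1 - 2^-1) *: (2 * s *: k).
  have -> : (1 - 2^-1 : R) = 2^-1 by lra.
  by rewrite !scalerA mulrA mulVf ?mul1r ?scalerDr.
have := D_conv (2 * s *: h) (2 * s *: k) half01.
have := D_semi (2 * s *: h) (2 * s *: k) half01.
rewrite -scalerBr normrZ exprMn real_normK ?num_real //.
have := dirder_le h s20; have := dirder_le k s20.
have := dirder_ge h s20; have := dirder_ge k s20.
have MM u : 0 <= M * `|u| ^+ 2 * s ^+ 2.
  by rewrite mulr_ge0 ?exprn_ge0 ?mulr_ge0 ?exprn_ge0 // ltW.
have := MM h; have := MM k; have := MM (h - k).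
rewrite ler_norml; move: (D _) => d *.
by apply/andP; split; lra.
Qed.

Let dirder0 : dirder 0 = 0.
Proof.
apply: (@dirder_uniq _ _ 0) => s s0.
by rewrite scaler0 D0 mulr0 subr0 normr0 mul0r.
Qed.

Let dirderN h : dirder (- h) = - dirder h.
Proof. by apply/eqP; rewrite -addr_eq0 -dirderD addNr dirder0. Qed.

Let dirderZ (c : R) h : dirder (c *: h) = c * dirder h.
Proof.
wlog c0 : c h / 0 < c.
  move=> H; have [c0|c0|->] := ltgtP c 0; last by rewrite scale0r mul0r dirder0.
    by rewrite -[c *: h]opprK -scaleNr dirderN H ?oppr_gt0 // mulNr opprK.
  exact: H.
apply: (@dirder_uniq _ _ (M / 2 * `|h| ^+ 2 * c ^+ 2)) => s s0.
have sc0 : 0 < s * c by rewrite mulr_gt0.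
rewrite scalerA ler_norml.
have := dirder_le h sc0; have := dirder_ge h sc0.
have : 0 <= M / 2 * `|h| ^+ 2 * (s * c) ^+ 2.
  by rewrite mulr_ge0 ?exprn_ge0 ?mulr_ge0 ?exprn_ge0 ?invr_ge0 // ltW.
by move=> *; apply/andP; split; lra.
Qed.

(** The directional derivative [dirder] is linear, and bounded because
    [dirder h <= F (x + h) - F x] on the unit ball; the contact vector is its
    Riesz representative. *)
Lemma convex_semiconcave_quad_touch :
  (exists B, forall h, `|h| <= 1 -> F (x + h) <= B) ->
  exists v, quad_touch F M x v.
Proof.
case=> B FB.
have dirder_bd h : dirder h <= (B - F x) * `|h|.
  have [->|h0] := eqVneq h 0; first by rewrite dirder0 normr0 mulr0.
  have hp : 0 < `|h| by rewrite normr_gt0.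
  rewrite -ler_pdivrMr // mulrC -dirderZ.
  have := dirder_le (`|h|^-1 *: h) ltr01; rewrite mul1r scale1r => H.
  apply: (le_trans H); rewrite /D lerB //; apply: FB.
  by rewrite normrZ normfV normr_id mulVf // gt_eqF.
have dirder_lin : linear (dirder : X -> R).
  by move=> a h k; rewrite dirderD dirderZ.
pose L : {linear X -> R} :=
  HB.pack (dirder : X -> R) (GRing.isLinear.Build R X R _ dirder dirder_lin).
have [|v Hv] := @riesz L.
  exists (B - F x) => h; rewrite ler_norml dirder_bd andbT lerNl.
  by rewrite -[- _]dirderN -(normrN h) dirder_bd.
exists v => h; rewrite -Hv /=.
have := dirder_le h ltr01; have := dirder_ge h ltr01.
by rewrite scale1r /D => H1 H2; apply/andP; split; lra.
Qed.

End DirectionalDerivative.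

(** * Descent lemma *)

Lemma is_derive_line F x h (t : R) : (forall y, differentiable F y) ->
  is_derive t 1 (fun s : R => F (s *: h + x))
    (ip (gradient ip F (t *: h + x)) h).
Proof.
move=> dF; rewrite -gradientP // -deriveE //.
have E : (fun s : R => s^-1 *: (F ((s *: 1 + t) *: h + x) - F (t *: h + x))) =
         (fun s => s^-1 *: (F (s *: h + (t *: h + x)) - F (t *: h + x))).
  by apply/funext => s; rewrite scalerDl addrA [_ *: 1]mulr1.
have := @diff_derivable _ _ _ _ _ h (dF (t *: h + x)).
by split; rewrite /derivable /derive /= E.
Qed.

(** The function [phi] below has derivative at most 0 on [0, 1] by
    Cauchy-Schwarz and the Lipschitz bound, and [phi 1 <= phi 0] is the
    claim. *)
Lemma descent F M x h : (forall y, differentiable F y) ->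
  (forall y z, `|gradient ip F y - gradient ip F z| <= M * `|y - z|) ->
  F (x + h) <= F x + ip (gradient ip F x) h + M / 2 * `|h| ^+ 2.
Proof.
move=> dF gF; set c := ip _ h; set K := M / 2 * _.
pose phi (t : R) := F (t *: h + x) - (t * c + K * t ^+ 2).
pose dphi (t : R) := ip (gradient ip F (t *: h + x)) h - (c + 2 * K * t).
have phi' (t : R) : is_derive t 1 phi (dphi t).
  apply: is_deriveB; first exact: is_derive_line.
  apply: is_derive_eq; rewrite /GRing.scale /=; lra.
have [|t] := @MVT R phi dphi 0 1 ltr01 (fun t _ => phi' t).
  apply: derivable_within_continuous => t _; exact: ex_derive.
rewrite in_itv /= subr0 mulr1 => /andP[t0 _].
rewrite /phi scale1r scale0r add0r (addrC h) => E.
have : dphi t <= 0.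
  have := ip_le_norm (gradient ip F (t *: h + x) - gradient ip F x) h.
  have := ler_wpM2r (normr_ge0 h) (gF (t *: h + x) x).
  rewrite addrK normrZ (gtr0_norm t0) ipBl -/c /dphi /K.
  move: (ip (gradient ip F (t *: h + x)) h) (c) `|_ - _| => A c' n; lra.
move: E; rewrite /K; lra.
Qed.

(** * The extension *)

Lemma ip_young (M : R) u v : 0 < M ->
  ip u v <= (2 * M)^-1 * `|u| ^+ 2 + M / 2 * `|v| ^+ 2.
Proof.
move=> M0; apply: (le_trans (ip_le_norm u v)).
have M20 : 0 < 2 * M by rewrite mulr_gt0.
rewrite -(ler_pM2l M20) [leRHS]mulrDr [X in X + _]mulrA mulfV ?gt_eqF // mul1r.
by have := sqr_ge0 (`|u| - M * `|v|); lra.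
Qed.

Lemma Lip_leP (u : X -> X) (M : R) : 0 <= M ->
  (Lip u <= M%:E)%E <-> forall x y, `|u x - u y| <= M * `|x - y|.
Proof.
move=> M0; split=> [uM x y|uM].
  have [->|xy] := eqVneq x y; first by rewrite !subrr normr0 mulr0.
  have xy0 : 0 < `|x - y| by rewrite normr_gt0 subr_eq0.
  rewrite -ler_pdivrMr // -lee_fin; apply: le_trans uM.
  by apply: ereal_sup_ubound; exists (x, y).
apply: ge_ereal_sup => _ [[x y] _ <-] /=; rewrite lee_fin.
have [->|xy] := eqVneq x y; first by rewrite !subrr normr0 mul0r.
by rewrite ler_pdivrMr ?normr_gt0 ?subr_eq0.
Qed.

Lemma quad_touch_C11 F M (G : X -> X) : 0 < M ->
  (forall x, quad_touch F M x (G x)) ->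
  C11 ip F /\ (Lip (gradient ip F) <= M%:E)%E.
Proof.
move=> M0 FG.
have gF : gradient ip F = G.
  by apply/funext => x; exact: (quad_touch_gradient (FG x)).2.
have GM := quad_touch_lipschitz M0 FG.
rewrite gF; split; last by apply/Lip_leP => //; exact: ltW.
split=> [x|]; first exact: (quad_touch_gradient (FG x)).1.
rewrite gF; have : \forall K \near (+oo : set_system R), M <= K.
  by apply: nbhs_pinfty_ge; exact: num_real.
apply: filterS => K MK [x y] _ /=; apply: (le_trans (GM x y)).
by rewrite ler_wpM2r.
Qed.

Section Extension.
Variables (E : set X) (f : X -> R) (G : X -> X) (M : R).
Hypotheses (E_neq0 : E !=set0) (M_gt0 : 0 < M) (fG_CW11 : CW11 ip E f G M).

Let parab y x := f y + ip (G y) (x - y) + M / 2 * `|x - y| ^+ 2.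

(** The constant in [CW11] is the one of Young's inequality for [G y - G z] and
    [y - x] with weight [M]. *)
Lemma tangent_le_paraboloid x y z : E y -> E z ->
  f z + ip (G z) (x - z) <= parab y x.
Proof.
move=> Ey Ez; have := fG_CW11 Ey Ez.
have := ip_young (G y - G z) (y - x) M_gt0.
rewrite (distrC y) /parab !ipE; lra.
Qed.

Let g x := fine (inf_paraboloids ip E f G M x).

Lemma inf_paraboloids_fin x : (g x)%:E = inf_paraboloids ip E f G M x.
Proof.
have [y Ey] := E_neq0; rewrite fineK // fin_numE; apply/andP; split.
  rewrite gt_eqF //.
  apply: lt_le_trans (_ : (f y + ip (G y) (x - y))%:E <= _)%E.
    exact: ltNyr.
  apply: le_ereal_inf_tmp => _ [z Ez <-]; rewrite lee_fin.
  exact: tangent_le_paraboloid.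
rewrite lt_eqF //; apply: le_lt_trans (ltry (parab y x)).
by apply: ereal_inf_lbound; exists y.
Qed.

Lemma inf_paraboloids_le x y : E y -> g x <= parab y x.
Proof.
move=> Ey; rewrite -lee_fin inf_paraboloids_fin; apply: ereal_inf_lbound.
by exists y.
Qed.

Lemma inf_paraboloids_ge x c : (forall y, E y -> c <= parab y x) -> c <= g x.
Proof.
move=> H; rewrite -lee_fin inf_paraboloids_fin.
apply: le_ereal_inf_tmp => _ [y Ey <-]; by rewrite lee_fin; exact: H.
Qed.

(** Each paraboloid satisfies the inequality with equality, by the
    parallelogram-type identity for [`|t *: a + (1 - t) *: b| ^+ 2]. *)
Lemma inf_paraboloids_semiconcave : semiconcave M g.
Proof.
move=> t a b /andP[t0 t1]; apply: inf_paraboloids_ge => y Ey.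
have t1' : 0 <= 1 - t by rewrite subr_ge0.
have := ler_wpM2l t0 (inf_paraboloids_le a Ey).
have := ler_wpM2l t1' (inf_paraboloids_le b Ey).
rewrite /parab -!ip_norm !ipE.
rewrite (ipC b a) (ipC y a) (ipC y b).
lra.
Qed.

Let F x := fine (conv_env g x).

Let tangent_convex z : convex_fun (fun x => f z + ip (G z) (x - z)).
Proof. by move=> t x y _; rewrite !ipE; lra. Qed.

Let tangent_lsc z : lsc (fun x => f z + ip (G z) (x - z)).
Proof.
apply: continuous_lsc => x; apply: cvgD; first exact: cvg_cst.
apply: (@continuous_comp _ _ _ (fun x => x - z) (ip (G z))); last first.
  exact: ip_lin_continuous.
by apply: cvgB; [exact: cvg_id|exact: cvg_cst].
Qed.

Let tangent_le_g z x : E z -> f z + ip (G z) (x - z) <= g x.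
Proof.
by move=> Ez; apply: inf_paraboloids_ge => y Ey; exact: tangent_le_paraboloid.
Qed.

Lemma conv_env_fin x : (F x)%:E = conv_env g x.
Proof.
have [z Ez] := E_neq0; rewrite fineK // fin_numE; apply/andP; split.
  rewrite gt_eqF //.
  apply: lt_le_trans (_ : (f z + ip (G z) (x - z))%:E <= _)%E.
    exact: ltNyr.
  apply: (le_conv_env (tangent_convex z) (tangent_lsc z)) => w.
  exact: tangent_le_g.
by rewrite lt_eqF //; apply: le_lt_trans (conv_env_le _ _) (ltry _).
Qed.

Let tangent_le_F z x : E z -> f z + ip (G z) (x - z) <= F x.
Proof.
move=> Ez; rewrite -lee_fin conv_env_fin.
apply: (le_conv_env (tangent_convex z) (tangent_lsc z)) => w.
exact: tangent_le_g.
Qed.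

Let F_le_parab z x : E z -> F x <= parab z x.
Proof.
move=> Ez; apply: le_trans (inf_paraboloids_le _ Ez).
by rewrite -lee_fin conv_env_fin conv_env_le.
Qed.

Lemma conv_env_interpolates z : E z -> F z = f z.
Proof.
move=> Ez; apply/eqP; rewrite eq_le; apply/andP; split.
  have := F_le_parab z Ez.
  by rewrite /parab subrr linear0r normr0 expr0n mulr0 !addr0.
by have := tangent_le_F z Ez; rewrite subrr linear0r addr0.
Qed.

(** The tangent and the paraboloid of index [z] agree to first order at [z] and
    enclose [F]. *)
Lemma conv_env_touch z : E z -> quad_touch F M z (G z).
Proof.
move=> Ez h; have := F_le_parab (z + h) Ez; have := tangent_le_F (z + h) Ez.
by rewrite /parab (addrC z) addrK (conv_env_interpolates Ez) => -> ->.
Qed.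

Lemma conv_env_touch_all x : exists v, quad_touch F M x v.
Proof.
have [z Ez] := E_neq0.
apply: convex_semiconcave_quad_touch (ltW M_gt0) _ _ _.
- exact: conv_env_convex conv_env_fin.
- exact: conv_env_semiconcave conv_env_fin _ inf_paraboloids_semiconcave.
(* a bound of the paraboloid of index [z] on the unit ball around [x] *)
exists (f z + `|G z| * (`|x - z| + 1) + M / 2 * (`|x - z| + 1) ^+ 2) => h h1.
apply: (le_trans (F_le_parab _ Ez)); rewrite /parab.
have n : `|x + h - z| <= `|x - z| + 1.
  by rewrite addrAC; apply: (le_trans (ler_normD _ _)); rewrite lerD2l.
apply: lerD; first rewrite lerD2l.
  by apply: (le_trans (ip_le_norm _ _)); rewrite ler_wpM2l.
by rewrite ler_wpM2l ?divr_ge0 ?(ltW M_gt0) // ler_sqr ?nnegrE ?addr_ge0.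
Qed.

Lemma conv_env_maximal (H : X -> R) : (forall x, differentiable H x) ->
  convex_fun H -> (forall x, E x -> H x = f x) ->
  (forall x, E x -> gradient ip H x = G x) ->
  (Lip (gradient ip H) <= M%:E)%E -> forall x, H x <= F x.
Proof.
move=> dH cH Hf HG /(Lip_leP _ (ltW M_gt0)) lH x.
rewrite -lee_fin conv_env_fin; apply: le_conv_env x => //.
  by apply: continuous_lsc => x; exact: differentiable_continuous.
move=> x; apply: inf_paraboloids_ge => y Ey.
by have := descent y (x - y) dH lH; rewrite subrKC (Hf _ Ey) (HG _ Ey).
Qed.

End Extension.
End InnerProduct.

Theorem theorem2p4 (R : realType) (X : completeNormedModType R)
    (ip : {dot X for idfun}) (ip_norm : forall x : X, ip x x = `|x| ^+ 2)
    (E : set X) (E_neq0 : E !=set0) (f : X -> R) (G : X -> X)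
    (M : R) (M_gt0 : 0 < M) (fG_CW11 : CW11 ip E f G M) :
  exists g F : X -> R,
    [/\ (forall x, (g x)%:E = inf_paraboloids ip E f G M x),
        (forall x, (F x)%:E = conv_env g x),
        [/\ C11 ip F,
            convex_function [set: convex_lmodType X] F,
            (forall x, E x -> F x = f x),
            (forall x, E x -> gradient ip F x = G x)
          & (Lip (gradient ip F) <= M%:E)%E]
      & forall H : X -> R,
          C11 ip H ->
          convex_function [set: convex_lmodType X] H ->
          (forall x, E x -> H x = f x) ->
          (forall x, E x -> gradient ip H x = G x) ->
          (Lip (gradient ip H) <= M%:E)%E ->
          forall x, H x <= F x].
Proof.
exists (fun x => fine (inf_paraboloids ip E f G M x)).
eexists; split.
- by move=> x; exact: inf_paraboloids_fin.
- by move=> x; exact: conv_env_fin.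
- have /choice[V touchV] x := conv_env_touch_all ip_norm E_neq0 M_gt0 fG_CW11 x.
  have [C11F LipF] := quad_touch_C11 ip_norm M_gt0 touchV.
  split=> //.
  + by apply/convex_funP; apply: conv_env_convex => x; exact: conv_env_fin.
  + by move=> x; exact: conv_env_interpolates.
  + move=> x Ex.
    have touchG := conv_env_touch ip_norm E_neq0 M_gt0 fG_CW11 Ex.
    by have [] := quad_touch_gradient ip_norm touchG.
- by move=> H [dH _] /convex_funP cH; exact: conv_env_maximal.
Qed.
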